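(* Given a linear program and an initial matrix $V$ as in the context, the BZ algorithm described in the context terminates after finitely many iterations, and the pair $(z^*,u^* )$ it returns is an optimal solution of the linear program $$Z^*=\max\{c'z+d'u : Az\le b,\ Hz+Gu\le h\}.$$
   Context: Let $c\in\mathbb{R}^n$, $d\in\mathbb{R}^m$, let $H,G$ be real matrices and $h$ a real vector of compatible dimensions; $u\in\mathbb{R}^m$ is free. The system $Az\le b$ consists of precedence constraints $z_i-z_j\le 0$ for $(i,j)\in I$ (with $I$ a given set of ordered pairs of indices) and the bound constraints $0\le z\le 1$. The linear program $$Z^*=\max\{c'z+d'u : Az\le b,\ Hz+Gu\le h\}$$ is assumed feasible with finite optimal value. The input matrix $V$ has columns that are nonzero, pairwise orthogonal $0$-$1$ vectors in $\mathbb{R}^n$ (i.e. with disjoint supports), and the span of its columns contains $z$ for at least one feasible $(z,u)$. Notation: for $x,y\in\{0,1\}^n$, $(x\wedge y)_i=1$ iff $x_i=y_i=1$, and $(x\setminus y)_i=1$ iff $x_i=1$ and $y_i=0$. Refining a matrix with orthogonal $0$-$1$ columns $v^1,\dots,v^r$ with a $0$-$1$ vector $\hat v$ means forming the matrix whose columns are the nonzero vectors of the collection $$\{v^j\wedge\hat v:1\le j\le r\}\cup\{v^j\setminus\hat v:1\le j\le r\}\cup\Big\{\hat v\setminus\sum_{j=1}^r v^j\Big\}.$$ BZ algorithm. Set $Z^U_0=\infty$, $V^1=V$. For $j=1,2,\dots$: (1) Solve the restricted master problem $$Z^L_j=\max\{c'V^j\lambda+d'u : AV^j\lambda\le b,\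 HV^j\lambda+Gu\le h\},$$ obtaining an optimal solution $(\lambda^j,u^j)$ and an optimal dual solution, whose part corresponding to the constraints $HV^j\lambda+Gu\le h$ is the row vector $\pi^j\ge0$; set $z^j=V^j\lambda^j$. (2) Solve the pricing problem $L(\pi^j)=\max\{c'v-\pi^j(Hv-h): Av\le b\}$, letting $v^j$ be a $0$-$1$ optimal solution (one exists because the polytope $\{v:Av\le b\}$ has only $0$-$1$ extreme points), and set $Z^U_j=\min\{L(\pi^j),Z^U_{j-1}\}$. (3) If $Z^L_j=Z^U_j$, stop and return $(z^*,u^* )=(z^j,u^j)$. Otherwise let $V^{j+1}$ be obtained by refining $V^j$ with $v^j$, and continue with $j+1$. *)

(* Defs.v *)
From HB Require Import structures.
From mathcomp Require Import all_boot all_order all_algebra.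
From mathcomp Require Import classical_sets constructive_ereal reals ereal.

Set Implicit Arguments.
Unset Strict Implicit.
Unset Printing Implicit Defensive.

Import Order.TTheory GRing.Theory Num.Theory.
Local Open Scope ring_scope.

(* -oo when infeasible, +oo when unbounded. *)
Definition opt_value (R : realType) (T : Type) (feas : set T) (obj : T -> R)
    : \bar R :=
  ereal_sup [set (obj x)%:E | x in feas]%classic.

Definition max_solution (R : realType) (T : Type) (feas : set T)
    (obj : T -> R) (x : T) : Prop :=
  feas x /\ forall y, feas y -> obj y <= obj x.

Definition min_solution (R : realType) (T : Type) (feas : set T)
    (obj : T -> R) (x : T) : Prop :=
  feas x /\ forall y, feas y -> obj x <= obj y.

Definition mxle (R : realType) (k l : nat) (M N : 'M[R]_(k, l)) : Prop :=
  forall i j, M i j <= N i j.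

Definition zero_one (R : realType) (n : nat) (x : 'cV[R]_n) : Prop :=
  forall i, x i 0 = 0 \/ x i 0 = 1.

Definition vand (R : realType) (n : nat) (x y : 'cV[R]_n) : 'cV[R]_n :=
  \col_i ((x i 0 == 1) && (y i 0 == 1))%:R.

Definition vdiff (R : realType) (n : nat) (x y : 'cV[R]_n) : 'cV[R]_n :=
  \col_i ((x i 0 == 1) && (y i 0 == 0))%:R.

Definition refine_cols (R : realType) (n r : nat) (V : 'M[R]_(n, r))
    (w : 'cV[R]_n) : seq 'cV[R]_n :=
  [seq x <- [seq vand (col k V) w | k <- enum 'I_r]
            ++ [seq vdiff (col k V) w | k <- enum 'I_r]
            ++ [:: vdiff w (\sum_(k < r) col k V)]
          | x != 0].

Definition refine_mx (R : realType) (n r : nat) (V : 'M[R]_(n, r))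
    (w : 'cV[R]_n) : 'M[R]_(n, size (refine_cols V w)) :=
  \matrix_(i, k) (nth 0 (refine_cols V w) k) i 0.

(* The system A z <= b is determined by the precedence pairs [lpI]; see [lpA]
   and [lpb]. *)
Record bz_lp (R : realType) (n m p : nat) := BzLp {
  lpc : 'cV[R]_n;
  lpd : 'cV[R]_m;
  lpH : 'M[R]_(p, n);
  lpG : 'M[R]_(p, m);
  lph : 'cV[R]_p;
  lpI : {set 'I_n * 'I_n}
}.

Section BZ.
Context (R : realType) (n m p : nat) (P : bz_lp R n m p).

Notation c := (lpc P).
Notation d := (lpd P).
Notation H := (lpH P).
Notation G := (lpG P).
Notation h := (lph P).

(* The rows of A are e_i - e_j for (i, j) in I, then the identity (z <= 1),
   then minus the identity (- z <= 0). *)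
Definition lpA : 'M[R]_(#|lpI P| + (n + n), n) :=
  col_mx
    (\matrix_(k < #|lpI P|)
       (delta_mx 0 (enum_val k).1 - delta_mx 0 (enum_val k).2 : 'rV[R]_n))
    (col_mx 1%:M (- 1%:M)).

Definition lpb : 'cV[R]_(#|lpI P| + (n + n)) :=
  col_mx 0 (col_mx (const_mx 1) 0).

Definition lp_feas : set ('cV[R]_n * 'cV[R]_m) :=
  fun zu => mxle (lpA *m zu.1) lpb /\ mxle (H *m zu.1 + G *m zu.2) h.

Definition lp_obj (zu : 'cV[R]_n * 'cV[R]_m) : R :=
  (c^T *m zu.1 + d^T *m zu.2) 0 0.

(* Restricted master problem, in the free variables (lambda, u). *)

Definition master_feas (r : nat) (V : 'M[R]_(n, r))
    : set ('cV[R]_r * 'cV[R]_m) :=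
  fun lu => mxle (lpA *m V *m lu.1) lpb
         /\ mxle (H *m V *m lu.1 + G *m lu.2) h.

Definition master_obj (r : nat) (V : 'M[R]_(n, r))
    (lu : 'cV[R]_r * 'cV[R]_m) : R :=
  (c^T *m V *m lu.1 + d^T *m lu.2) 0 0.

(* Its linear programming dual, in the variables (alpha, pi); the constraints
   are equations because lambda and u are free. *)

Definition dual_feas (r : nat) (V : 'M[R]_(n, r))
    : set ('rV[R]_(#|lpI P| + (n + n)) * 'rV[R]_p) :=
  fun ap => [/\ mxle 0 ap.1, mxle 0 ap.2,
                ap.1 *m (lpA *m V) + ap.2 *m (H *m V) = c^T *m V
              & ap.2 *m G = d^T].

Definition dual_obj (ap : 'rV[R]_(#|lpI P| + (n + n)) * 'rV[R]_p) : R :=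
  (ap.1 *m lpb + ap.2 *m h) 0 0.

Definition pricing_feas : set 'cV[R]_n := fun v => mxle (lpA *m v) lpb.

Definition pricing_obj (pi : 'rV[R]_p) (v : 'cV[R]_n) : R :=
  (c^T *m v - pi *m (H *m v - h)) 0 0.

(* State at the start of iteration j: the matrix V^j together with its number
   of columns, and the upper bound Z^U_{j-1}. *)
Record bz_state := BzState {
  st_r : nat;
  st_V : 'M[R]_(n, st_r);
  st_ZU : \bar R
}.

Definition bz_init (r : nat) (V : 'M[R]_(n, r)) : bz_state :=
  BzState V +oo%E.

Definition master_choice (s : bz_state)
    (lu : 'cV[R]_(st_r s) * 'cV[R]_m) : Prop :=
  max_solution (master_feas (st_V s)) (master_obj (st_V s)) lu.

Definition dual_choice (s : bz_state)
    (ap : 'rV[R]_(#|lpI P| + (n + n)) * 'rV[R]_p) : Prop :=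
  min_solution (dual_feas (st_V s)) dual_obj ap.

Definition pricing_choice (pi : 'rV[R]_p) (v : 'cV[R]_n) : Prop :=
  max_solution pricing_feas (pricing_obj pi) v /\ zero_one v.

Definition bz_ZL (s : bz_state) : \bar R :=
  opt_value (master_feas (st_V s)) (master_obj (st_V s)).

Definition bz_ZU (s : bz_state) (pi : 'rV[R]_p) : \bar R :=
  mine (opt_value pricing_feas (pricing_obj pi)) (st_ZU s).

(* The algorithm is nondeterministic: any optimal primal, dual and 0-1 pricing
   solutions may be selected in an iteration. *)

Definition bz_returns (s : bz_state) (zu : 'cV[R]_n * 'cV[R]_m) : Prop :=
  exists lu ap v,
    [/\ @master_choice s lu, dual_choice s ap, pricing_choice ap.2 v,
        bz_ZL s = bz_ZU s ap.2
      & zu = (st_V s *m lu.1, lu.2)].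

Definition bz_next (s s' : bz_state) : Prop :=
  exists lu ap v,
    [/\ @master_choice s lu, dual_choice s ap, pricing_choice ap.2 v,
        bz_ZL s <> bz_ZU s ap.2
      & s' = BzState (refine_mx (st_V s) v) (bz_ZU s ap.2)].

Inductive bz_reachable (s0 : bz_state) : bz_state -> Prop :=
| bz_reach0 : bz_reachable s0 s0
| bz_reachS s s' : bz_reachable s0 s -> bz_next s s' -> bz_reachable s0 s'.

(* Every step of the iteration starting at s can be carried out, whatever
   dual solution has been selected. *)
Definition bz_executable (s : bz_state) : Prop :=
  [/\ exists lu, @master_choice s lu,
      exists ap, dual_choice s ap
    & forall ap, dual_choice s ap -> exists v, pricing_choice ap.2 v].

Definition bz_terminates (s0 : bz_state) : Prop :=
  (forall s, bz_reachable s0 s -> bz_executable s) /\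
  ~ (exists s : nat -> bz_state, s 0%N = s0 /\ forall j, bz_next (s j) (s j.+1)).

End BZ.

(* Main.v *)
Require Import Defs.
From mathcomp Require Import all_boot all_order all_algebra.
From mathcomp Require Import classical_sets constructive_ereal reals ereal.
From mathcomp Require Import lra.
Import Order.TTheory GRing.Theory Num.Theory.
Local Open Scope ring_scope.

(** The pricing problem is a Lagrangian relaxation of the linear program, so
    L(pi) is at least Z* for every dual solution pi ([pricing_bound]), while a
    restricted master value is at most Z*. Hence Z^L_j <= Z* <= Z^U_j in every
    iteration, and when the two bounds meet the master solution is optimal for
    the linear program ([bz_returns_max]).

    Termination is a rank argument. If the pricing solution v^j already lies in
    the span of V^j, then dual feasibility (an equation along the columns of
    V^j) bounds L(pi^j) by the value of the dual solution, which is Z^L_j by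
    strong duality; the bounds then meet and the algorithm stops
    ([bz_span_stop]). So in every iteration that continues, v^j is outside the
    span of V^j. As long as the columns of V^j are 0-1 vectors with disjoint
    supports, the refined matrix spans both V^j and v^j ([refine_span]), and its
    columns have the same shape again ([disjoint_01_refine]). The rank of V^j
    therefore increases in every iteration that continues, but it is at most
    n ([bz_no_infinite_run]). Since the spans grow, the master problem also
    remains feasible.

    That every iteration can be carried out needs two existence results. The
    restricted master problem is feasible and bounded by Z*, so it and its dual
    attain a common value: this is linear programming duality ([lp_duality]),
    derived here from the Farkas lemma ([farkas]). The pricing problem has a 0-1
    optimal solution because every vector satisfying the precedence and bound
    constraints is a nonnegative combination of indicators of
    precedence-closed sets, namely its upper level sets ([threshold_bound]). *)

(** * Entrywise order on matrices *)

Lemma entryD {R : realType} {k l : nat} (M N : 'M[R]_(k, l)) i j :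
  (M + N) i j = M i j + N i j.
Proof. by rewrite mxE. Qed.

Lemma entryN {R : realType} {k l : nat} (M : 'M[R]_(k, l)) i j :
  (- M) i j = - M i j.
Proof. by rewrite mxE. Qed.

Lemma entryZ {R : realType} {k l : nat} a (M : 'M[R]_(k, l)) i j :
  (a *: M) i j = a * M i j.
Proof. by rewrite mxE. Qed.

Lemma mx_ge0P {R : realType} {k l : nat} (M : 'M[R]_(k, l)) :
  mxle 0 M <-> forall i j, 0 <= M i j.
Proof. by split=> le0M i j; have := le0M i j; rewrite mxE. Qed.

Lemma mx_le0P {R : realType} {k l : nat} (M : 'M[R]_(k, l)) :
  mxle M 0 <-> forall i j, M i j <= 0.
Proof. by split=> leM0 i j; move: (leM0 i j); rewrite [(0 : 'M__) i j]mxE. Qed.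

Lemma mxle_mull {R : realType} {k l q : nat} (Y : 'M[R]_(k, l))
    (M N : 'M[R]_(l, q)) :
  mxle 0 Y -> mxle M N -> mxle (Y *m M) (Y *m N).
Proof.
move=> Y0 MN i j; rewrite !mxE; apply: ler_sum => t _.
by apply: ler_wpM2l => //; have := Y0 i t; rewrite mxE.
Qed.

Lemma mxle_col_mx {R : realType} {k1 k2 l : nat} (M1 N1 : 'M[R]_(k1, l))
    (M2 N2 : 'M[R]_(k2, l)) :
  mxle (col_mx M1 M2) (col_mx N1 N2) <-> mxle M1 N1 /\ mxle M2 N2.
Proof.
split=> [le_MN|[le1 le2] i j].
  split=> i j; first by have := le_MN (lshift _ i) j; rewrite !col_mxEu.
  by have := le_MN (rshift _ i) j; rewrite !col_mxEd.
rewrite -(splitK i); case: (split i) => i' /=; first by rewrite !col_mxEu.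
by rewrite !col_mxEd.
Qed.

Lemma mxle0_row_mx {R : realType} {k l1 l2 : nat} (M1 : 'M[R]_(k, l1))
    (M2 : 'M[R]_(k, l2)) :
  mxle 0 (row_mx M1 M2) <-> mxle 0 M1 /\ mxle 0 M2.
Proof.
split=> [le0M|[le1 le2] i j].
  split=> i j; first by have := le0M i (lshift _ j); rewrite row_mxEl !mxE.
  by have := le0M i (rshift _ j); rewrite row_mxEr !mxE.
rewrite -(splitK j); case: (split j) => j' /=; rewrite ?row_mxEl ?row_mxEr.
  by have := le1 i j'; rewrite !mxE.
by have := le2 i j'; rewrite !mxE.
Qed.

(** * Farkas lemma and linear programming duality *)

(** Induction on the number of rows, following Bartl. If the separating vector
    x0 found for the remaining rows N fails on the new row a, rescale it so that
    a x0 = 1. Subtracting from each row, and from g, its value at x0 times a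
    gives rows that vanish at x0, to which the induction hypothesis applies
    again. A combination found there lifts by putting a suitable weight on a,
    which is nonnegative because N x0 <= 0 < g x0; a separating x found there
    lifts by projecting it along x0 to the hyperplane where a vanishes. *)
Lemma farkas {R : realType} {k l : nat} (N : 'M[R]_(k, l)) (g : 'rV[R]_l) :
  (exists2 y : 'rV[R]_k, mxle 0 y & y *m N = g) \/
  (exists2 x : 'cV[R]_l, mxle (N *m x) 0 & 0 < (g *m x) 0 0).
Proof.
elim: k N g => [|k IHk]; last rewrite -(add1n k); move=> N g.
  have [->|/rV0Pn[j gj]] := eqVneq g 0.
    by left; exists 0; [move=> i j; rewrite mxE | rewrite mul0mx].
  right; exists (g 0 j *: delta_mx j 0); first by case.
  by rewrite -scalemxAr -colE !mxE -expr2 exprn_even_gt0 //= gj.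
rewrite -[N]vsubmxK; move: (usubmx _) (dsubmx _) => a {}N.
have [[y y0 <-]|[x0 Nx0 gx0]] := IHk N g.
  left; exists (row_mx 0 y : 'rV_(1 + k)).
    by apply/mxle0_row_mx; split=> // i j; rewrite mxE.
  by rewrite mul_row_col mul0mx add0r.
have [ax0|ax0] := lerP ((a *m x0) 0 0) 0.
  right; exists x0 => //; rewrite mul_col_mx -col_mx0; apply/mxle_col_mx.
  by split=> //; apply/mx_le0P => i j; rewrite !ord1.
(* Rescale x0 so that a x0 = 1. *)
pose e := ((a *m x0) 0 0)^-1.
have e0 : 0 < e by rewrite invr_gt0.
have axe : a *m (e *: x0) = 1%:M.
  by rewrite -scalemxAr [a *m x0]mx11_scalar -scalemx1 scalerA mulVf ?gt_eqF ?scale1r.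
have {}Nx0 : mxle (N *m (e *: x0)) 0.
  move/mx_le0P: Nx0 => Nx0; apply/mx_le0P => i j.
  by rewrite -scalemxAr entryZ pmulr_rle0.
have {}gx0 : 0 < (g *m (e *: x0)) 0 0 by rewrite -scalemxAr entryZ mulr_gt0.
move: (e *: x0) axe Nx0 gx0 => {x0 e e0 ax0} x0 ax0 Nx0 gx0.
have [[y y0 yN]|[x Nx gx]] := IHk (N - N *m x0 *m a) (g - g *m x0 *m a).
  left; exists (row_mx (g *m x0 - y *m N *m x0) y : 'rV_(1 + k)).
    apply/mxle0_row_mx; split=> //; apply/mx_ge0P => i j; rewrite !ord1.
    have := mxle_mull _ _ _ y0 Nx0; rewrite mulmx0 mulmxA => /mx_le0P/(_ 0 0) le0.
    by rewrite entryD entryN; lra.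
  rewrite mul_row_col mulmxBl -addrA [- _ + _]addrC.
  by move: yN; rewrite mulmxBr !mulmxA => ->; rewrite addrC subrK.
right; exists (x - x0 *m (a *m x)).
  rewrite mul_col_mx -col_mx0; apply/mxle_col_mx; split.
    rewrite mulmxBr [a *m (x0 *m _)]mulmxA ax0 mul1mx subrr.
    by move=> i j; rewrite mxE.
  by rewrite mulmxBr !mulmxA -mulmxBl.
by rewrite mulmxBr !mulmxA -mulmxBl.
Qed.

(** Affine form of the Farkas lemma: an inequality f x <= Z implied by a
    consistent system M x <= q is a nonnegative combination of its rows and of
    the trivial inequality 0 <= 1. The last row of the block matrix stands for
    the trivial inequality. *)
Lemma lp_dual_bound {R : realType} {k l : nat} (M : 'M[R]_(k, l)) (q : 'cV[R]_k)
    (f : 'rV[R]_l) (x1 : 'cV[R]_l) (Z : R) :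
    mxle (M *m x1) q ->
    (forall x, mxle (M *m x) q -> (f *m x) 0 0 <= Z) ->
  exists y, [/\ mxle 0 y, y *m M = f & (y *m q) 0 0 <= Z].
Proof.
move=> Mx1 leZ.
have [[ys ys0]|[xt]] :=
    farkas (block_mx M q 0 1%:M : 'M_(k + 1, l + 1)) (row_mx f Z%:M).
  move: ys0; rewrite -[ys]hsubmxK; move: (lsubmx _) (rsubmx _) => y s.
  case/mxle0_row_mx=> y0 s0.
  rewrite mul_row_block mulmx0 addr0 mulmx1 => /eq_row_mx [yM].
  move=> /(congr1 (fun A : 'M_1 => A 0 0)); rewrite [LHS]mxE [RHS]mxE mulr1n => yqZ.
  exists y; split=> //; have := (mx_ge0P s).1 s0 0 0.
  by lra.
rewrite -[xt]vsubmxK; move: (usubmx _) (dsubmx _) => x t.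
rewrite mul_block_col -col_mx0 mul0mx add0r mul1mx => /mxle_col_mx[le1 le2].
rewrite mul_row_col entryD.
have := (mx_le0P _).1 le2 0 0; move: le1 {le2}.
rewrite [t]mx11_scalar; move: (t 0 0) => {}t.
rewrite mul_mx_scalar -scalar_mxM [t%:M _ _]mxE [(Z * t)%:M _ _]mxE !mulr1n.
move=> /mx_le0P le1 t0 fxZ.
(* A violation of the bound, either at the point x / (- t) or far along the
   ray from x1 in the direction x. *)
have [t_eq0|t_neq0] := eqVneq t 0.
  rewrite t_eq0 mulr0 addr0 in fxZ.
  have fx_neq0 : (f *m x) 0 0 != 0 by rewrite gt_eqF.
  pose e := (Z - (f *m x1) 0 0 + 1) / (f *m x) 0 0.
  have e0 : 0 <= e by rewrite divr_ge0 ?ltW //; have := leZ _ Mx1; lra.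
  have /leZ : mxle (M *m (x1 + e *: x)) q.
    move=> i j; rewrite mulmxDr -scalemxAr entryD entryZ.
    have := le1 i j; rewrite t_eq0 scale0r addr0 => Mx.
    by have := Mx1 i j; have := mulr_ge0_le0 e0 Mx; lra.
  by rewrite mulmxDr -scalemxAr entryD entryZ divfK //; lra.
have {t_neq0} {}t0 : 0 < - t by rewrite oppr_gt0 lt_neqAle t_neq0.
have /leZ : mxle (M *m ((- t)^-1 *: x)) q.
  move=> i j; rewrite -scalemxAr entryZ mulrC ler_pdivrMr //.
  by have := le1 i j; rewrite entryD entryZ; lra.
by rewrite -scalemxAr entryZ mulrC ler_pdivrMr //; lra.
Qed.

(** Let Z be the supremum of the objective. If Z were not attained, the Farkas
    lemma applied to the homogenized system M x <= t q, f x >= t Z, t > 0 would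
    yield a bound on f x below Z. The affine form then gives a dual solution
    of value at most Z. *)
Lemma lp_duality {R : realType} {k l : nat} (M : 'M[R]_(k, l)) (q : 'cV[R]_k)
    (f : 'rV[R]_l) (x1 : 'cV[R]_l) (B : R) :
    mxle (M *m x1) q ->
    (forall x, mxle (M *m x) q -> (f *m x) 0 0 <= B) ->
  exists x y, [/\ mxle (M *m x) q, mxle 0 y, y *m M = f
    & (f *m x) 0 0 = (y *m q) 0 0].
Proof.
move=> Mx1 leB.
pose vals := [set (f *m x) 0 0 | x in [set x | mxle (M *m x) q]]%classic.
pose Z := sup vals.
have sup_vals : has_sup vals.
  split; first by exists ((f *m x1) 0 0), x1.
  by exists B => _ [x Mx <-]; apply: leB.
have leZ x : mxle (M *m x) q -> (f *m x) 0 0 <= Z.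
  by move=> Mx; apply: sup_upper_bound => //; exists x.
have Zle C : (forall x, mxle (M *m x) q -> (f *m x) 0 0 <= C) -> Z <= C.
  move=> leC; apply: ge_sup; first by case: sup_vals.
  by move=> _ [x Mx <-]; apply: leC.
have weak (y : 'rV_k) x : mxle 0 y -> mxle (M *m x) q ->
    (y *m M *m x) 0 0 <= (y *m q) 0 0.
  by move=> y0 Mx; rewrite -mulmxA; apply: mxle_mull.
have [x Mx fxZ] : exists2 x, mxle (M *m x) q & Z <= (f *m x) 0 0.
  have [[ys ys0]|[xt]] := farkas (block_mx M (- q) (- f) Z%:M)
                       (row_mx 0 1%:M : 'rV_(l + 1)).
    move: ys0; rewrite -[ys]hsubmxK; move: (lsubmx _) (rsubmx _) => y s.
    case/mxle0_row_mx=> y0 s0.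
    rewrite mul_row_block => /eq_row_mx [].
    rewrite [s]mx11_scalar mul_scalar_mx mulmxN scalerN => /eqP.
    rewrite subr_eq0 => /eqP yM /(congr1 (fun A : 'M_1 => A 0 0)).
    have := (mx_ge0P s).1 s0 0 0; move: (s 0 0) yM => {}s yM {}s0.
    rewrite -scalar_mxM entryD entryN ![_%:M _ _]mxE !mulr1n => ysZ.
    have key x : mxle (M *m x) q -> s * (f *m x) 0 0 <= s * Z - 1.
      by move=> Mx; have := weak y x y0 Mx; rewrite yM -scalemxAl entryZ; lra.
    (* s = 0 would make key read 0 <= -1 at the feasible point x1. *)
    have {s0} s0 : 0 < s.
      rewrite lt_neqAle s0 andbT; apply/eqP => s_eq0.
      by have := key _ Mx1; rewrite -s_eq0; lra.
    suff : Z <= Z - s^-1 by rewrite lerDl oppr_ge0 invr_le0 leNgt s0.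
    apply: Zle => x /key le_sfx.
    by rewrite -(ler_pM2l s0) mulrBr divff // gt_eqF.
  rewrite -[xt]vsubmxK; move: (usubmx _) (dsubmx _) => x t.
  rewrite mul_block_col -col_mx0 => /mxle_col_mx[le1 le2].
  rewrite mul_row_col mul0mx add0r mul1mx => t0.
  move: le1 le2 t0; rewrite [t]mx11_scalar; move: (t 0 0) => {}t.
  rewrite !mul_mx_scalar scalerN scale_scalar_mx mxE mulr1n.
  move=> /mx_le0P le1 /mx_le0P le2 t0.
  exists (t^-1 *: x).
    move=> i j; rewrite -scalemxAr entryZ mulrC ler_pdivrMr // mulrC.
    have := le1 i j.
    by rewrite entryD entryN entryZ subr_le0 !ord1.
  rewrite -scalemxAr entryZ mulrC ler_pdivlMr //.
  have := le2 0 0; rewrite mulNmx entryD entryN [_%:M _ _]mxE mulr1n.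
  by lra.
have [y [y0 yM yq]] := lp_dual_bound _ _ _ _ _ Mx1 leZ.
exists x, y; split=> //; apply/eqP; rewrite eq_le (le_trans yq) // andbT.
by rewrite -yM weak.
Qed.

(** * Optimal values *)

Lemma opt_value_max {R : realType} {T : Type} (feas : set T) (obj : T -> R) x :
  max_solution feas obj x -> opt_value feas obj = (obj x)%:E.
Proof.
move=> [feas_x max_x]; apply/eqP; rewrite eq_le; apply/andP; split.
  by apply: ge_ereal_sup => _ [y feas_y <-]; rewrite lee_fin max_x.
by apply: ereal_sup_ubound; exists x.
Qed.

Lemma opt_value_ge {R : realType} {T : Type} (feas : set T) (obj : T -> R) x :
  feas x -> ((obj x)%:E <= opt_value feas obj)%E.
Proof. by move=> feas_x; apply: ereal_sup_ubound; exists x. Qed.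

(** * The pricing problem *)

Lemma pricing_feasP {R : realType} {n m p : nat} (P : bz_lp R n m p) v :
  pricing_feas P v <->
  (forall ij, ij \in lpI P -> v ij.1 0 <= v ij.2 0) /\
  (forall i, 0 <= v i 0 <= 1).
Proof.
rewrite /pricing_feas /lpA /lpb !mul_col_mx mul1mx mulNmx mul1mx.
set E := \matrix_(k < _) _.
have EvE k : (E *m v) k 0 = v (enum_val k).1 0 - v (enum_val k).2 0.
  transitivity (row k (E *m v) 0 0); first by rewrite [RHS]mxE.
  by rewrite row_mul rowK mulmxBl -!rowE !mxE.
split=> [/mxle_col_mx[/mx_le0P leI /mxle_col_mx[le1 le0]]|[leI le01]].
  split=> [ij Iij|i].
    by have := leI (enum_rank_in Iij ij) 0; rewrite EvE enum_rankK_in // subr_le0.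
  have := le1 i 0; have := le0 i 0; rewrite !mxE oppr_le0 => -> ->.
  by [].
apply/mxle_col_mx; split.
  by apply/mx_le0P => k j; rewrite ord1 EvE subr_le0 leI // enum_valP.
apply/mxle_col_mx; split=> i j; rewrite ord1 !mxE ?oppr_le0;
  by case/andP: (le01 i).
Qed.

Definition precedence_closed {n : nat} (I : {set 'I_n * 'I_n})
    (S : {set 'I_n}) :=
  [forall ij in I, (ij.1 \in S) ==> (ij.2 \in S)].

Definition indicator {R : realType} {n : nat} (S : {set 'I_n}) : 'cV[R]_n :=
  \col_i (i \in S)%:R.

(** Layer-cake rounding, by induction on the size of the support. The support
    S of v is precedence closed; subtracting from v its smallest positive value
    t times the indicator of S keeps the precedence constraints, lowers the
    upper bound s by t and removes at least one index from the support. *)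
Lemma threshold_bound {R : realType} {n : nat} (I : {set 'I_n * 'I_n})
    (g : 'rV[R]_n) (B s : R) (v : 'cV[R]_n) :
    (forall S, precedence_closed I S -> (g *m indicator S) 0 0 <= B) ->
    (forall ij, ij \in I -> v ij.1 0 <= v ij.2 0) ->
    0 <= s -> (forall i, 0 <= v i 0 <= s) ->
  (g *m v) 0 0 <= s * B.
Proof.
move=> leB.
have B0 : 0 <= B.
  suff <- : (g *m indicator finset.set0) 0 0 = 0.
    by apply: leB; apply/forall_inP => ij _; rewrite finset.in_set0.
  by rewrite mxE big1 // => i _; rewrite mxE finset.in_set0 mulr0.
have [N] := ubnP #|[set i | 0 < v i 0]|.
elim: N => // N IHN in s v *; rewrite ltnS => leN leI s0 le0s.
have [supp0|[i0]] := finset.set_0Vmem [set i | 0 < v i 0].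
  have -> : v = 0.
    apply/colP => i; rewrite mxE; apply/eqP; rewrite eq_le.
    have /andP[-> _] := le0s i; rewrite andbT leNgt.
    by have /setP/(_ i) := supp0; rewrite !inE => ->.
  by rewrite mulmx0 mxE mulr_ge0.
rewrite inE => v_i0.
set S := [set i | 0 < v i 0] in leN.
have [t0 S_t0 min_t0] := @arg_minP _ _ _ i0 (fun i => 0 < v i 0) (fun i => v i 0) v_i0.
set t := v t0 0 in S_t0 min_t0.
have S_closed : precedence_closed I S.
  apply/forall_inP => ij Iij; apply/implyP; rewrite !inE => v_gt0.
  exact: lt_le_trans (leI _ Iij).
pose v' := v - t *: indicator S.
have v'E i : v' i 0 = if 0 < v i 0 then v i 0 - t else 0.
  rewrite !mxE !inE; case: ifP => [_|/negbT]; first by rewrite mulr1.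
  rewrite -leNgt mulr0 subr0 => v_le0; apply/eqP; rewrite eq_le v_le0.
  by case/andP: (le0s i).
have t_le_s : t <= s by case/andP: (le0s t0).
have : (g *m v') 0 0 <= (s - t) * B.
  apply: IHN => [|ij Iij||i].
  - apply: leq_trans leN; apply: proper_card; apply/properP; split.
      apply/fintype.subsetP => i; rewrite !inE v'E; case: ifP => //.
      by rewrite ltxx.
    by exists t0; rewrite !inE ?v'E ?S_t0 // subrr ltxx.
  - have leij := leI _ Iij; rewrite !v'E.
    case: ifP => [v_gt0|_]; first by rewrite (lt_le_trans v_gt0) // lerD2r.
    by case: ifP => // /min_t0; rewrite subr_ge0.
  - by rewrite subr_ge0.
  rewrite v'E; case: ifP => [v_gt0|_]; last by rewrite lexx subr_ge0.
  by rewrite subr_ge0 min_t0 //= lerD2r; case/andP: (le0s i).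
have := leB _ S_closed; set gS := g *m indicator S => le_gS.
rewrite mulmxBr -scalemxAr -/gS entryD entryN entryZ.
have /ler_wpM2l leMt : 0 <= t by rewrite ltW.
by have := leMt _ _ le_gS; lra.
Qed.

(** The best precedence-closed indicator is optimal by rounding, with s = 1. *)
Lemma pricing_max {R : realType} {n m p : nat} (P : bz_lp R n m p) pi :
  exists v, pricing_choice P pi v.
Proof.
pose g := (lpc P)^T - pi *m lpH P.
have objE v : pricing_obj P pi v = (g *m v) 0 0 + (pi *m lph P) 0 0.
  rewrite /pricing_obj /g mulmxBr mulmxBl mulmxA !(entryD, entryN); lra.
pose w S := (g *m @indicator R n S) 0 0.
have closed0 : precedence_closed (lpI P) finset.set0.
  by apply/forall_inP => ij _; rewrite finset.in_set0.
have [S S_closed max_S] := @arg_maxP _ _ _ _ (precedence_closed (lpI P)) w closed0.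
exists (indicator S); split; first split.
- apply/pricing_feasP; split=> [ij Iij|i]; last first.
    by rewrite mxE; case: (_ \in _); rewrite ?lexx ?ler01.
  rewrite !mxE; have /forall_inP/(_ _ Iij) := S_closed.
  by case: (ij.1 \in S) => /= [->|_]; rewrite ?ler0n.
- move=> v /pricing_feasP[leI le01]; rewrite !objE lerD2r -[leRHS]mul1r.
  exact: (threshold_bound (lpI P)).
- by move=> i; rewrite mxE; case: (_ \in _); [right|left].
Qed.

(** * Refinement *)

(** For 0-1 columns, the supports are disjoint exactly when the sum of the
    columns is again a 0-1 vector; in this form the property passes to the
    refinement by one computation of a sum. *)
Definition disjoint_01 {R : realType} {n r : nat} (V : 'M[R]_(n, r)) : Prop :=
  (forall k, zero_one (col k V)) /\ zero_one (\sum_(k < r) col k V).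

Lemma orthogonal_disjoint_01 {R : realType} {n r : nat} (V : 'M[R]_(n, r)) :
    (forall k, zero_one (col k V)) ->
    (forall k l, k != l -> (col k V)^T *m col l V = 0) ->
  disjoint_01 V.
Proof.
move=> V01 Vorth; split=> // i; rewrite summxE.
have V01' k : V i k = 0 \/ V i k = 1 by have := V01 k i; rewrite mxE.
have [k Vik|noV] := pickP (fun k => V i k == 1).
  right; rewrite (bigD1 k) //= mxE (eqP Vik) big1 ?addr0 // => l lk.
  rewrite mxE; case: (V01' l) => // Vil.
  have := Vorth k l; rewrite eq_sym lk => /(_ isT)/(congr1 (fun A : 'M_1 => A 0 0)).
  rewrite [LHS]mxE [RHS]mxE (bigD1 i) //= !mxE (eqP Vik) Vil mulr1 => /eqP.
  rewrite gt_eqF // ltr_wpDr // sumr_ge0 // => i' _.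
  rewrite !mxE; have := V01 k i'; have := V01 l i'; rewrite !mxE.
  by do 2![case=> ->]; rewrite ?mulr0 ?mulr1.
left; rewrite big1 // => k _; rewrite mxE; case: (V01' k) => // /eqP.
by have := noV k => /= ->.
Qed.

Lemma zero_eq1 (R : realType) : ((0 : R) == 1) = false.
Proof. by rewrite eq_sym oner_eq0. Qed.

Lemma vandD_vdiff {R : realType} {n : nat} (x y : 'cV[R]_n) :
  zero_one x -> zero_one y -> vand x y + vdiff x y = x.
Proof.
move=> x01 y01; apply/colP => i; rewrite !mxE.
by case: (x01 i) => ->; case: (y01 i) => ->;
  rewrite ?eqxx ?oner_eq0 ?zero_eq1 /= ?addr0 ?add0r.
Qed.

(** The zero vectors dropped by the refinement do not affect the sum. *)
Lemma refine_cols_sum {R : realType} {n r : nat} (V : 'M[R]_(n, r))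
    (w : 'cV[R]_n) :
  \sum_(x <- refine_cols V w) x
  = \sum_k (vand (col k V) w + vdiff (col k V) w)
    + vdiff w (\sum_k col k V).
Proof.
rewrite /refine_cols big_filter big_mkcond /= (eq_bigr id); last first.
  by move=> x _; case: eqP => [->|].
rewrite !big_cat /= big_seq1 !big_map -!big_enum addrA.
by rewrite big_split /=.
Qed.

(** The refined columns sum to the old sum of columns plus the part of w outside
    of it, that is, to the indicator of the union of all supports. *)
Lemma disjoint_01_refine {R : realType} {n r : nat} (V : 'M[R]_(n, r))
    (w : 'cV[R]_n) :
  disjoint_01 V -> zero_one w -> disjoint_01 (refine_mx V w).
Proof.
move=> [V01 sumV01] w01.
have colE k : col k (refine_mx V w) = nth 0 (refine_cols V w) k.
  by apply/colP => i; rewrite !mxE.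
split=> [k|].
  rewrite colE.
  have := mem_nth 0 (ltn_ord k); rewrite mem_filter => /andP[_].
  have b01 (b : bool) : b%:R = 0 :> R \/ b%:R = 1 :> R by case: b; [right|left].
  rewrite !mem_cat => /or3P[/mapP[l _ ->]|/mapP[l _ ->]|]; last rewrite inE => /eqP->.
  - by move=> i; rewrite mxE.
  - by move=> i; rewrite mxE.
  - by move=> i; rewrite mxE.
have -> : \sum_k col k (refine_mx V w) = \sum_(x <- refine_cols V w) x.
  by rewrite (big_nth 0) big_mkord; apply: eq_bigr => k _.
rewrite refine_cols_sum (eq_bigr (fun k => col k V)) => [|k _].
  move=> i; rewrite mxE [vdiff _ _ _ _]mxE.
  case: (sumV01 i) => ->; rewrite ?eqxx ?oner_eq0 ?andbT ?andbF ?add0r ?addr0.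
    by case: (_ == _); [right|left].
  by right.
by rewrite vandD_vdiff.
Qed.

(** Each column of V splits into its parts inside and outside w, and w splits
    into its parts inside the columns and the part outside all of them. The
    spans of columns are expressed as row spaces of transposes. *)
Lemma refine_span {R : realType} {n r : nat} (V : 'M[R]_(n, r))
    (w : 'cV[R]_n) :
    disjoint_01 V -> zero_one w ->
  (V^T <= (refine_mx V w)^T)%MS /\ (w^T <= (refine_mx V w)^T)%MS.
Proof.
move=> [V01 sumV01] w01; set V' := refine_mx V w.
have sub_mem x : x \in [seq vand (col k V) w | k <- enum 'I_r]
            ++ [seq vdiff (col k V) w | k <- enum 'I_r]
            ++ [:: vdiff w (\sum_(k < r) col k V)] -> (x^T <= V'^T)%MS.
  move=> x_in; have [->|x_neq0] := eqVneq x 0; first by rewrite trmx0 sub0mx.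
  have : x \in refine_cols V w by rewrite mem_filter x_neq0.
  case/(nthP 0) => k k_lt <-.
  suff -> : nth 0 (refine_cols V w) k = col (Ordinal k_lt) V'.
    by rewrite tr_col row_sub.
  by apply/colP => i; rewrite !mxE.
have sub_and k : ((vand (col k V) w)^T <= V'^T)%MS.
  by apply: sub_mem; rewrite mem_cat; apply/orP; left; apply/mapP; exists k;
    rewrite ?mem_enum.
have sub_diff k : ((vdiff (col k V) w)^T <= V'^T)%MS.
  apply: sub_mem; rewrite !mem_cat; apply/or3P/Or32/mapP; exists k;
    by rewrite ?mem_enum.
have sub_last : ((vdiff w (\sum_(k < r) col k V))^T <= V'^T)%MS.
  by apply: sub_mem; rewrite !mem_cat mem_seq1 eqxx !orbT.
split.
  apply/row_subP => k; rewrite -tr_col -(vandD_vdiff _ _ (V01 k) w01) linearD /=.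
  exact: addmx_sub.
suff -> : w^T = (\sum_k vand (col k V) w + vdiff w (\sum_k col k V))^T.
  by rewrite linearD linear_sum /= addmx_sub ?summx_sub.
congr trmx; apply/colP => i; rewrite mxE summxE [vdiff _ _ _ _]mxE.
rewrite (eq_bigr (fun k => col k V i 0 * w i 0)) => [|k _]; last first.
  rewrite [LHS]mxE; case: (V01 k i) => ->; case: (w01 i) => ->;
  by rewrite ?eqxx ?oner_eq0 ?zero_eq1 /= ?mulr0 ?mul0r ?mulr1.
rewrite -mulr_suml -summxE.
by case: (sumV01 i) => ->; case: (w01 i) => ->;
  rewrite ?eqxx ?oner_eq0 ?zero_eq1 /= ?mulr0 ?mul0r ?mulr1 ?addr0 ?add0r.
Qed.

(** * The restricted master problem *)

(** Lagrangian relaxation: pi G = d turns d u into pi G u, which is at most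
    pi (h - H z) when (z, u) is feasible. *)
Lemma pricing_bound {R : realType} {n m p : nat} (P : bz_lp R n m p)
    (pi : 'rV[R]_p) zu :
    mxle 0 pi -> pi *m lpG P = (lpd P)^T -> lp_feas P zu ->
  lp_obj P zu <= pricing_obj P pi zu.1.
Proof.
move=> pi0 piG [_ /(mxle_mull _ _ _ pi0)/(_ 0 0)].
rewrite mulmxDr [pi *m (lpG P *m _)]mulmxA piG /lp_obj /pricing_obj mulmxBr.
by rewrite !(entryD, entryN); lra.
Qed.

Lemma master_feasE {R : realType} {n m p r : nat} (P : bz_lp R n m p)
    (V : 'M[R]_(n, r)) lu :
  master_feas P V lu = lp_feas P (V *m lu.1, lu.2).
Proof. by rewrite /master_feas /lp_feas !mulmxA. Qed.

Lemma master_objE {R : realType} {n m p r : nat} (P : bz_lp R n m p)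
    (V : 'M[R]_(n, r)) lu :
  master_obj P V lu = lp_obj P (V *m lu.1, lu.2).
Proof. by rewrite /master_obj /lp_obj !mulmxA. Qed.

Lemma master_weak_duality {R : realType} {n m p r : nat} (P : bz_lp R n m p)
    (V : 'M[R]_(n, r)) lu ap :
  master_feas P V lu -> dual_feas (P := P) V ap ->
  master_obj P V lu <= dual_obj (P := P) ap.
Proof.
move=> [le1 le2] [a0 pi0 dualV dualG]; rewrite /master_obj /dual_obj.
have := mxle_mull _ _ _ a0 le1 0 0; have := mxle_mull _ _ _ pi0 le2 0 0.
rewrite -dualV -dualG mulmxDr mulmxDl !mulmxA => {}le2 {}le1.
by move: le1 le2; rewrite !entryD; lra.
Qed.

(** An instance of [lp_duality], with (lambda, u) and the two groups of dual
    variables stacked into single vectors. *)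
Lemma master_strong_duality {R : realType} {n m p r : nat} (P : bz_lp R n m p)
    (V : 'M[R]_(n, r)) lu0 B :
    master_feas P V lu0 ->
    (forall lu, master_feas P V lu -> master_obj P V lu <= B) ->
  exists lu ap, [/\ max_solution (master_feas P V) (master_obj P V) lu,
    min_solution (dual_feas (P := P) V) (dual_obj (P := P)) ap
    & master_obj P V lu = dual_obj (P := P) ap].
Proof.
move=> feas0 leB.
pose M := block_mx (lpA P *m V) 0 (lpH P *m V) (lpG P).
pose q := col_mx (lpb P) (lph P).
pose f := row_mx ((lpc P)^T *m V) (lpd P)^T.
have feasE l u : mxle (M *m col_mx l u) q <-> master_feas P V (l, u).
  by rewrite mul_block_col mul0mx addr0; apply: mxle_col_mx.
have objE l u : (f *m col_mx l u) 0 0 = master_obj P V (l, u).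
  by rewrite mul_row_col.
have [x [y [feas_x y0 yM xy]]] : exists x y, [/\ mxle (M *m x) q, mxle 0 y,
    y *m M = f & (f *m x) 0 0 = (y *m q) 0 0].
  apply: (lp_duality _ _ _ (col_mx lu0.1 lu0.2) B).
    by apply/feasE; case: lu0 feas0.
  by move=> x; rewrite -[x]vsubmxK feasE objE; apply: leB.
move: feas_x y0 yM xy; rewrite -[x]vsubmxK -[y]hsubmxK.
move: (usubmx x) (dsubmx x) (lsubmx y) (rsubmx y) => l u a pi.
rewrite feasE objE mxle0_row_mx mul_row_block mul_row_col mulmx0 add0r.
move=> feas_lu [a0 pi0] /eq_row_mx[dualV dualG] lu_ap.
have dual_ap : dual_feas (P := P) V (a, pi) by split.
exists (l, u), (a, pi); split=> //; split=> //.
  by move=> lu' feas'; rewrite lu_ap (master_weak_duality _ V _ (a, pi)).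
by move=> ap' dual'; rewrite -[leLHS]lu_ap (master_weak_duality _ V (l, u)).
Qed.

(** * Correctness of the algorithm *)

(** The last two clauses keep the master problem feasible and Z^U_{j-1} an
    upper bound of Z*; the first one makes refinement enlarge the span. *)
Definition bz_inv {R : realType} {n m p : nat} (P : bz_lp R n m p)
    (s : bz_state R n) : Prop :=
  [/\ disjoint_01 (st_V s), exists lu, master_feas P (st_V s) lu
    & (opt_value (lp_feas P) (lp_obj P) <= st_ZU s)%E].

Lemma bz_duality {R : realType} {n m p : nat} (P : bz_lp R n m p) s :
    opt_value (lp_feas P) (lp_obj P) \is a fin_num ->
  bz_inv P s ->
  exists lu ap, [/\ master_choice P (s := s) lu, dual_choice (P := P) s ap
    & master_obj P (st_V s) lu = dual_obj (P := P) ap].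
Proof.
move=> P_finite [_ [lu0 feas0] _].
pose B := fine (opt_value (lp_feas P) (lp_obj P)).
apply: (master_strong_duality _ _ _ B feas0) => lu.
rewrite master_feasE master_objE -lee_fin fineK //.
exact: opt_value_ge.
Qed.

(** The algorithm may select any optimal dual solution; all of them have the
    optimal value of the master problem. *)
Lemma bz_ZL_dual {R : realType} {n m p : nat} (P : bz_lp R n m p) s ap :
    opt_value (lp_feas P) (lp_obj P) \is a fin_num ->
  bz_inv P s -> dual_choice (P := P) s ap ->
  bz_ZL P s = (dual_obj (P := P) ap)%:E.
Proof.
move=> P_finite /(bz_duality _ _ P_finite).
move=> [lu [ap' [max_lu [feas' min'] eq_val]]] [feas min].
rewrite /bz_ZL (opt_value_max _ _ _ max_lu) eq_val; congr _%:E.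
by apply/eqP; rewrite eq_le min' //= min.
Qed.

Lemma bz_ZU_ge {R : realType} {n m p : nat} (P : bz_lp R n m p) s ap v :
    bz_inv P s -> dual_choice (P := P) s ap ->
    pricing_choice P ap.2 v ->
  (opt_value (lp_feas P) (lp_obj P) <= bz_ZU P s ap.2)%E.
Proof.
move=> [_ _ leZU] [[_ pi0 _ dualG] _] [max_v _].
rewrite /bz_ZU le_min leZU andbT; apply: ge_ereal_sup => _ [zu feas_zu <-].
apply: le_trans (opt_value_ge _ _ zu.1 _); last by case: feas_zu.
by rewrite lee_fin pricing_bound.
Qed.

Lemma bz_ZL_le {R : realType} {n m p : nat} (P : bz_lp R n m p) s :
  (bz_ZL P s <= opt_value (lp_feas P) (lp_obj P))%E.
Proof.
apply: ge_ereal_sup => _ [lu feas_lu <-]; rewrite master_objE.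
by apply: opt_value_ge; rewrite -master_feasE.
Qed.

(** Write v = V l. Then c v - pi H v = alpha A v by dual feasibility, hence
    L(pi) <= alpha b + pi h = Z^L, and the bounds Z^L <= Z* <= Z^U collapse. *)
Lemma bz_span_stop {R : realType} {n m p : nat} (P : bz_lp R n m p) s ap v :
    opt_value (lp_feas P) (lp_obj P) \is a fin_num ->
  bz_inv P s -> dual_choice (P := P) s ap ->
    pricing_choice P ap.2 v -> (v^T <= (st_V s)^T)%MS ->
  bz_ZL P s = bz_ZU P s ap.2.
Proof.
move=> P_finite inv_s dual_ap price_v /submxP[l /(congr1 trmx)].
rewrite trmx_mul !trmxK => vE.
apply/eqP; rewrite eq_le (le_trans (bz_ZL_le P s)) /=; last first.
  exact: bz_ZU_ge price_v.
rewrite (bz_ZL_dual _ _ _ P_finite inv_s dual_ap) /bz_ZU ge_min; apply/orP; left.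
have [max_v _] := price_v; rewrite (opt_value_max _ _ _ max_v) lee_fin.
have [[a0 pi0 dualV dualG] _] := dual_ap; have [feas_v _] := max_v.
have := mxle_mull _ _ _ a0 feas_v 0 0.
have -> : ap.1 *m (lpA P *m v) = (lpc P)^T *m v - ap.2 *m (lpH P *m v).
  by rewrite vE !mulmxA -dualV mulmxDl !mulmxA addrK.
by rewrite /pricing_obj /dual_obj mulmxBr !(entryD, entryN); lra.
Qed.

(** The rank increases because v lies in the span of the new matrix but, by
    [bz_span_stop], not in that of the old one. *)
Lemma bz_next_inv {R : realType} {n m p : nat} (P : bz_lp R n m p) s s' :
    opt_value (lp_feas P) (lp_obj P) \is a fin_num ->
  bz_inv P s -> bz_next P s s' ->
  bz_inv P s' /\ (\rank (st_V s) < \rank (st_V s'))%N.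
Proof.
move=> P_finite inv_s [lu [ap [v [max_lu dual_ap price_v neq ->]]]] /=.
have [disj_V _ _] := inv_s; have [_ v01] := price_v.
have [subV subv] := refine_span _ _ disj_V v01.
split.
  split=> /=; first exact: disjoint_01_refine.
    have /submxP[D /(congr1 trmx)] := subV; rewrite trmx_mul !trmxK => VE.
    exists (D^T *m lu.1, lu.2); rewrite master_feasE /= mulmxA -VE -master_feasE.
    by case: max_lu.
  exact: bz_ZU_ge price_v.
rewrite -mxrank_tr -[X in (_ < X)%N]mxrank_tr; apply: rank_ltmx.
rewrite ltmxE subV; apply/negP => subV'; apply: neq.
by apply: (bz_span_stop _ _ _ v) => //; apply: submx_trans subv subV'.
Qed.

Lemma bz_reachable_inv {R : realType} {n m p : nat} (P : bz_lp R n m p) s0 s :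
    opt_value (lp_feas P) (lp_obj P) \is a fin_num ->
  bz_inv P s0 -> bz_reachable P s0 s -> bz_inv P s.
Proof.
move=> P_finite inv0; elim=> // {}s s' _ inv_s /(bz_next_inv _ _ _ P_finite inv_s).
by case.
Qed.

Lemma bz_executable_inv {R : realType} {n m p : nat} (P : bz_lp R n m p) s :
    opt_value (lp_feas P) (lp_obj P) \is a fin_num ->
  bz_inv P s -> bz_executable P s.
Proof.
move=> P_finite /(bz_duality _ _ P_finite)[lu [ap [max_lu dual_ap _]]].
by split=> [||ap' _]; [exists lu|exists ap|apply: pricing_max].
Qed.

Lemma bz_no_infinite_run {R : realType} {n m p : nat} (P : bz_lp R n m p)
    (s : nat -> bz_state R n) :
    opt_value (lp_feas P) (lp_obj P) \is a fin_num -> bz_inv P (s 0%N) ->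
  ~ (forall j, bz_next P (s j) (s j.+1)).
Proof.
move=> P_finite inv0 run.
have rank_ge j : bz_inv P (s j) /\ (j <= \rank (st_V (s j)))%N.
  elim: j => // j [inv_j le_j].
  have [inv_j1 lt_j] := bz_next_inv _ _ _ P_finite inv_j (run j).
  by split=> //; apply: leq_ltn_trans lt_j.
have [_] := rank_ge n.+1; rewrite leqNgt ltnS.
by rewrite -mxrank_tr rank_leq_col.
Qed.

(** The value of the returned pair is Z^L = Z^U, and Z^U bounds Z* from
    above. *)
Lemma bz_returns_max {R : realType} {n m p : nat} (P : bz_lp R n m p) s zu :
  bz_inv P s -> bz_returns P s zu -> max_solution (lp_feas P) (lp_obj P) zu.
Proof.
move=> inv_s [lu [ap [v [max_lu dual_ap price_v ZLU ->]]]].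
split=> [|zu' feas']; first by rewrite -master_feasE; case: max_lu.
rewrite -lee_fin -master_objE -(opt_value_max _ _ _ max_lu) -/(bz_ZL P s) ZLU.
by apply: le_trans (bz_ZU_ge _ _ _ _ inv_s dual_ap price_v); apply: opt_value_ge.
Qed.

Theorem mainTheorem3 (R : realType) (n m p r : nat) (P : bz_lp R n m p)
    (V : 'M[R]_(n, r))
    (P_feasible : exists zu, lp_feas P zu)
    (P_finite : opt_value (lp_feas P) (lp_obj P) \is a fin_num)
    (V_zero_one : forall k, zero_one (col k V))
    (V_nonzero : forall k, col k V != 0)
    (V_orthogonal : forall k l, k != l -> (col k V)^T *m col l V = 0)
    (V_span : exists (l : 'cV[R]_r) (u : 'cV[R]_m), lp_feas P (V *m l, u)) :
  bz_terminates P (bz_init V) /\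
  forall s zu, bz_reachable P (bz_init V) s -> bz_returns P s zu ->
    max_solution (lp_feas P) (lp_obj P) zu.
Proof.
have inv0 : bz_inv P (bz_init V).
  split; first exact: orthogonal_disjoint_01.
    by have [l [u feas_lu]] := V_span; exists (l, u); rewrite master_feasE.
  exact: leey.
split; last first.
  by move=> s zu /(bz_reachable_inv _ _ _ P_finite inv0); apply: bz_returns_max.
split=> [s /(bz_reachable_inv _ _ _ P_finite inv0)|[s [s0 run]]].
  exact: bz_executable_inv.
by apply: (bz_no_infinite_run _ s P_finite _ run); rewrite s0.
Qed.
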